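(* Let $m\ge2$, let $\vec\Delta=(\Delta_1,\dots,\Delta_m)$ be a system of bounded intervals $\Delta_j=[a_j,b_j]\subset\mathbb R$ with $\Delta_j\cap\Delta_{j+1}=\varnothing$, $j=1,\dots,m-1$, and let $\vec w=(w_1,\dots,w_m)$ be a vector of non-negative functions with $\ln w_j\in L_1(\eta_{\Delta_j})$, $j=1,\dots,m$. Let $\overline m=\lceil m/2\rceil$. Then the $\overline m$-fold composition $\vec T_{\vec w}^{\overline m}$ of the map $\vec T_{\vec w}$ with itself is a contraction on the complete metric space $(\mathcal C^+(\vec\Delta),d)$; more precisely, for all $\vec f,\vec g\in\mathcal C^+(\vec\Delta)$, $$d(\vec T_{\vec w}^{\overline m}\vec f,\vec T_{\vec w}^{\overline m}\vec g)\le\gamma_m\,d(\vec f,\vec g),\qquad \gamma_m:=\begin{cases}(2^{\overline m}-1)/2^{\overline m},& m\text{ even},\\ (2^{\overline m}-2)/2^{\overline m},& m\text{ odd}.\end{cases}$$ The map $\vec T_{\vec w}$ has a unique fixed point.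
   Context: Convention: $\Delta_0=\Delta_{m+1}=\varnothing$. For $\Delta=[a,b]$, $d\eta_\Delta(x)=dx/\sqrt{(b-x)(x-a)}$ on $\Delta$. $\mathcal C^+(\vec\Delta)$ is the set of vector functions $\vec f=(f_1,\dots,f_m)$ such that $f_j$ is positive and continuous on $\Delta_{j-1}\cup\Delta_{j+1}$, with the distance $$d(\vec f,\vec g)=\max_{1\le j\le m}\|\ln(f_j/g_j)\|_{\Delta_{j-1}\cup\Delta_{j+1}},$$ where $\|\cdot\|_{\Delta_{j-1}\cup\Delta_{j+1}}$ is the sup norm on that set. Szegő function: for a non-negative function $v$ on $\Delta=[a,b]$ with $\ln v\in L_1(\eta_\Delta)$, the Szegő function on $\overline{\mathbb C}\setminus\Delta$ with boundary values $|S(x)|^2=1/v(x)$ a.e. on $\Delta$ is $$S(z)=\exp\Big[\frac{\sqrt{(z-b)(z-a)}}{2\pi}\int_\Delta\frac{\ln v(x)}{x-z}\,d\eta_\Delta(x)\Big]$$ (the root is positive for $z>b$); it is holomorphic and non-vanishing in $\overline{\mathbb C}\setminus\Delta$, and positive on $(\mathbb R\cup\{\infty\})\setminus\Delta$. The map $\vec T_{\vec w}=(T_1,\dots,T_m):\mathcal C^+(\vec\Delta)\to\mathcal C^+(\vec\Delta)$ is defined by: for $\vec f=(f_1,\dots,f_m)$, $T_j\vec f$ is (the restriction to $\Delta_{j-1}\cup\Delta_{j+1}$ of) the Szegő function on $\overline{\mathbb C}\setminus\Delta_j$ whose boundary values satisfy $$|T_j\vec f(x)|^2=\frac{f_{j-1}(x)f_{j+1}(x)}{w_j(x)}\quad\text{a.e.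 on }\Delta_j,\qquad j=1,\dots,m,$$ with $f_0\equiv f_{m+1}\equiv1$. *)

(* Defs.v *)
From HB Require Import structures.
From mathcomp Require Import all_boot all_order all_algebra.
From mathcomp Require Import all_classical all_reals all_analysis.
From mathcomp Require Import complex.

Set Implicit Arguments.
Unset Strict Implicit.
Unset Printing Implicit Defensive.

Import Order.TTheory GRing.Theory Num.Theory.
Import numFieldNormedType.Exports.

Local Open Scope classical_set_scope.
Local Open Scope ring_scope.
Local Open Scope complex_scope.

Section Szego.
Context {R : realType}.
Implicit Types (a b : R) (v : R -> R) (z : R[i]).

Definition cexp z : R[i] :=
  (expR (complex.Re z) * cos (complex.Im z)) +i*
  (expR (complex.Re z) * sin (complex.Im z)).

(* Density of [eta_[a,b]] with respect to the Lebesgue measure; the value 0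
   that it takes at the endpoints is immaterial. *)
Definition eta_density a b (x : R) : R := (Num.sqrt ((b - x) * (x - a)))^-1.

Definition eta_integrable a b (h : R -> \bar R) : Prop :=
  lebesgue_measure.-integrable `[a, b]
    (fun x => h x * (eta_density a b x)%:E)%E.

Definition eta_integral a b (F : R -> R[i]) : R[i] :=
  (\int[lebesgue_measure]_(x in `[a, b]) (complex.Re (F x) *
    eta_density a b x))%R
  +i*
  (\int[lebesgue_measure]_(x in `[a, b]) (complex.Im (F x) *
    eta_density a b x))%R.

(* [sqrtc] is the principal square root.  The cuts of the two factors cancel
   on ]-oo, a[, so the product is the branch of sqrt ((z - b) (z - a)) that is
   holomorphic off [a, b] and positive for z > b. *)
Definition sqrt_branch a b z : R[i] := sqrtc (z - b%:C) * sqrtc (z - a%:C).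

(* [ln] is 0 on nonpositive reals; this differs from ln v only on the set
   {v = 0}, which is negligible as soon as ln v is in L_1. *)
Definition szego a b v z : R[i] :=
  cexp (sqrt_branch a b z / (2 * pi)%:C *
        eta_integral a b (fun x => (ln (v x))%:C / (x%:C - z))).

End Szego.

Section Cplus.
Context {R : realType} {m : nat}.
Variables (a b : 'I_m -> R).

Definition neighbours (i j : 'I_m) : bool :=
  (i.+1 == j :> nat) || (j.+1 == i :> nat).

(* Delta_{j-1} `|` Delta_{j+1}; a neighbour outside the index range
   contributes the empty set. *)
Definition nbr_dom (j : 'I_m) : set R :=
  \bigcup_(i in [set i | neighbours i j]) `[a i, b i]%classic.

Record Cplus := MkCplus {
  cplus_fun :> forall j : 'I_m, nbr_dom j -> R;
  cplus_gt0 : forall j (x : nbr_dom j), 0 < cplus_fun x;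
  cplus_continuous : forall j, continuous (@cplus_fun j) }.
Arguments cplus_fun : clear implicits.

Definition cplus_dist (f g : Cplus) : R :=
  \big[Order.max/0]_(j < m)
    sup (range (fun x : nbr_dom j => `|ln (f j x / g j x)|)).

Lemma compact_nbr_dom j : compact (nbr_dom j).
Proof.
have -> : nbr_dom j =
    \big[setU/set0]_(i < m | neighbours i j) `[a i, b i]%classic.
  by rewrite -bigcup_pred.
by apply: bigsetU_compact => i _; exact: segment_compact.
Qed.

Lemma cplus_has_ubound (f g : Cplus) j :
  has_ubound (range (fun x : nbr_dom j => `|ln (f j x / g j x)|)).
Proof.
set h := fun x : nbr_dom j => _.
have ch : continuous h.
  move=> x; apply: (@continuous_comp _ _ _ (fun x : nbr_dom j => ln (f j x / g j x))
    (fun y : R => `|y|)); last exact: norm_continuous.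
  have gx0 : g j x != 0 by rewrite gt_eqF// cplus_gt0.
  apply: (@continuous_comp _ _ _ (fun x : nbr_dom j => f j x / g j x) (@ln R)).
    apply: continuousM; first exact: cplus_continuous.
    by apply: continuousV => //; exact: cplus_continuous.
  by apply: continuous_ln; rewrite divr_gt0// cplus_gt0.
have -> : range h = 'valL_0 h @` nbr_dom j.
  rewrite -{1}(valLK 0 h); apply/seteqP; split => [_ [x _ <-]|_ [x jx <-]].
    by exists (val x) => //; exact: set_valP.
  by exists (exist _ x (mem_set jx)).
have : compact ('valL_0 h @` nbr_dom j).
  apply: continuous_compact; last exact: compact_nbr_dom.
  exact/subspace_valL_continuousP'.
by move=> /compact_bounded[M [_ /(_ (M + 1))]]; rewrite ltrDl ltr01 => /(_ isT) hM;
  exists (M + 1) => y /hM; exact/le_trans/ler_norm.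
Qed.

Lemma le_cplus_dist (f g : Cplus) j (x : nbr_dom j) :
  `|ln (f j x / g j x)| <= cplus_dist f g.
Proof.
apply: le_trans (le_bigmax _ _ j).
by apply: ub_le_sup; [exact: cplus_has_ubound | exists x].
Qed.

Lemma cplus_dist_le (f g : Cplus) c : 0 <= c ->
  (forall j (x : nbr_dom j), `|ln (f j x / g j x)| <= c) ->
  cplus_dist f g <= c.
Proof.
move=> c0 fgc; apply/bigmax_leP; split=> // j _.
have [->|/set0P ne] := eqVneq
  (range (fun x : nbr_dom j => `|ln (f j x / g j x)|)) set0.
  by rewrite sup0.
by apply: ge_sup => // _ [x _ <-].
Qed.

Lemma cplus_dist_ge0 (f g : Cplus) : 0 <= cplus_dist f g.
Proof. exact: bigmax_ge_id. Qed.

Lemma cplus_distxx (f : Cplus) : cplus_dist f f = 0.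
Proof.
apply/eqP; rewrite eq_le cplus_dist_ge0 andbT; apply: cplus_dist_le => // j x.
by rewrite divff ?ln1 ?normr0// gt_eqF// cplus_gt0.
Qed.

Lemma cplus_dist_positivity (f g : Cplus) : cplus_dist f g = 0 -> f = g.
Proof.
move=> fg0; have fgE : cplus_fun f = cplus_fun g.
  apply: functional_extensionality_dep => j; apply/funext => x.
  have := le_cplus_dist f g x; rewrite fg0 normr_le0 ln_div ?posrE ?cplus_gt0//.
  by rewrite subr_eq0 => /eqP/ln_inj; apply; rewrite posrE cplus_gt0.
case: f g fgE {fg0} => [f f0 fc] [g g0 gc] /= fgE.
by subst g; congr MkCplus; exact: Prop_irrelevance.
Qed.

Lemma cplus_dist_sym (f g : Cplus) : cplus_dist f g = cplus_dist g f.
Proof.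
have le_sym (h k : Cplus) : cplus_dist h k <= cplus_dist k h.
  apply: cplus_dist_le => [|j x]; first exact: cplus_dist_ge0.
  rewrite -normrN -lnV ?invf_div ?le_cplus_dist//.
  by rewrite posrE divr_gt0// cplus_gt0.
by apply/eqP; rewrite eq_le !le_sym.
Qed.

Lemma cplus_dist_triangle (g f h : Cplus) :
  cplus_dist f h <= cplus_dist f g + cplus_dist g h.
Proof.
apply: cplus_dist_le => [|j x]; first by rewrite addr_ge0// cplus_dist_ge0.
have -> : ln (f j x / h j x) = ln (f j x / g j x) + ln (g j x / h j x).
  by rewrite !ln_div ?posrE ?cplus_gt0// addrA subrK.
by rewrite (le_trans (ler_normD _ _))// lerD// le_cplus_dist.
Qed.

HB.instance Definition _ := gen_eqMixin Cplus.
HB.instance Definition _ := gen_choiceMixin Cplus.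
HB.instance Definition _ := isMetric.Build R Cplus
  cplus_distxx cplus_dist_positivity cplus_dist_sym cplus_dist_triangle.

(* [f_0 = f_{m+1} = 1] is accounted for by the product ranging over existing
   neighbours only.  For such a neighbour [i], the domain [nbr_dom i] of [f i]
   contains [a j, b j], so the value 1 off [nbr_dom i] plays no role.  This
   determines [T]; that such a self-map of [Cplus] exists has to be proved. *)
Definition is_szego_map (w : 'I_m -> R -> R) (T : Cplus -> Cplus) : Prop :=
  forall (f : Cplus) (j : 'I_m) (x : nbr_dom j),
    (T f j x)%:C =
    szego (a j) (b j)
      (fun t => w j t / \prod_(i < m | neighbours i j) 'valL_1 (f i) t)
      (\val x)%:C.

End Cplus.

Arguments cplus_fun {R m a b} _ _ _.

Definition contraction_rate (R : realType) (m : nat) : R :=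
  let p : R := 2 ^+ uphalf m in
  if odd m then (p - 2) / p else (p - 1) / p.

(* Main.v *)
(** Off [a_j, b_j], ln (T_j f) is -1/2 times the integral of
    ln (w_j / prod_i f_i), i ranging over the neighbours of j, against the
    harmonic measure of the complement of [a_j, b_j], a probability measure.
    Taking the difference for f and g, the weight w_j cancels, so u = ln (f / g)
    becomes at j an average of (u_(j-1) + u_(j+1)) / 2 with u_0 = u_(m+1) = 0.
    After k steps the norm at j is at most d(f, g) times the probability that a
    simple random walk on 0, ..., m+1 started at j has not been absorbed at 0 or
    m+1.  For k = uphalf m at least one of the 2^k paths is absorbed, and at
    least two if m is odd.  The fixed point comes from Banach's theorem for the
    uphalf m-th iterate. *)

Require Import Defs.
From mathcomp Require Import all_boot all_order all_algebra.
From mathcomp Require Import all_classical all_reals all_analysis.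
From mathcomp Require Import measurable_realfun complex lra ring zify.

Set Implicit Arguments.
Unset Strict Implicit.
Unset Printing Implicit Defensive.

Import Order.TTheory GRing.Theory Num.Theory.
Import numFieldNormedType.Exports.

Local Open Scope classical_set_scope.
Local Open Scope ring_scope.

(* A lower bound for the number of k-step paths from j that have visited 0. *)
Definition exits (k j : nat) : nat := (j <= k) + (j < k).

(** An upper bound, for [k <= m], for the probability that the walk started at [j] is not yet
    absorbed after [k] steps. So few steps cannot meet both ends, so the two counts may be added. *)
Definition walk_bound (R : realType) (m k j : nat) : R :=
  1 - (exits k j + exits k (m.+1 - j))%:R / 2 ^+ k.

(** * Survival of a simple random walk between two absorbing ends *)

Section Walk.
Context {R : realType}.

Lemma sum_neighbours (m : nat) (G : nat -> R) (j : 'I_m) :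
  \sum_(i < m | neighbours i j) G i =
  (if (0 < j)%N then G j.-1 else 0) + (if (j.+1 < m)%N then G j.+1 else 0).
Proof.
have -> : \sum_(i < m | neighbours i j) G i =
    \sum_(i < m | i.+1 == j :> nat) G i + \sum_(i < m | j.+1 == i :> nat) G i.
  rewrite (bigID (fun i : 'I_m => i.+1 == j :> nat)) /=; congr (_ + _).
    by apply: eq_bigl => i; rewrite /neighbours andbC andb_orr andbb orb_idr// => /andP[].
  apply: eq_bigl => i; rewrite /neighbours.
  by case: (eqVneq i.+1 (j : nat)) => //= <-; case: eqP => // /esym; lia.
congr (_ + _).
  case: (ltnP 0 j) => j0; last first.
    by rewrite big_pred0// => i; apply/negbTE/eqP; lia.
  have jm : (j.-1 < m)%N by rewrite (leq_ltn_trans (leq_pred _)).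
  rewrite (big_pred1 (Ordinal jm))// => i /=.
  by rewrite -val_eqE/=; apply/eqP/eqP; lia.
case: (ltnP j.+1 m) => jm; last first.
  by rewrite big_pred0// => i; apply/negbTE/eqP; have := ltn_ord i; lia.
by rewrite (big_pred1 (Ordinal jm))// => i /=; rewrite -val_eqE/= eq_sym.
Qed.

(** For [k <= m] the far end is out of reach, so from an end site the exits number 1 if [k = 0] and
    2 otherwise, never more than [2 ^ k]. *)
Lemma walk_bound_border (m k : nat) : (k <= m)%N ->
  0 <= walk_bound R m k 0 /\ 0 <= walk_bound R m k m.+1.
Proof.
move=> km; rewrite /walk_bound subn0 subnn addnC.
suff : (exits k m.+1 + exits k 0)%:R / 2 ^+ k <= 1 :> R by split; lra.
rewrite ler_pdivrMr ?exprn_gt0// mul1r -natrX ler_nat /exits.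
case: k km => [|k] km; first by rewrite expn0; lia.
rewrite expnS; have : (0 < 2 ^ k)%N by rewrite expn_gt0.
by lia.
Qed.

(** Conditioning on the first step: a first step towards 0 already accounts for the whole count,
    [exits k.+1 j.+1 = exits k j], and symmetrically at the other end. *)
Lemma walk_bound_step (m k j : nat) : (j < m)%N ->
  2^-1 * (walk_bound R m k j + walk_bound R m k j.+2)
    <= walk_bound R m k.+1 j.+1.
Proof.
move=> jm; rewrite /walk_bound exprS.
have k0 : 0 < 2 ^+ k :> R by rewrite exprn_gt0.
set N := (_ + _)%N; set M := (_ + _)%N; set P := (_ + _)%N.
have : (P <= N + M)%N by rewrite /P /M /N /exits; lia.
rewrite -(ler_nat R) natrD => PNM.
rewrite -subr_ge0.
have -> : 1 - P%:R / (2 * 2 ^+ k) - 2^-1 * (1 - N%:R / 2 ^+ k + (1 - M%:R / 2 ^+ k))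
    = (N%:R + M%:R - P%:R) / (2 * 2 ^+ k) :> R by field; rewrite lt0r_neq0.
by apply: divr_ge0; [rewrite subr_ge0 | rewrite mulr_ge0// ltW].
Qed.

(** The distances [j.+1] and [m - j] to the ends add up to [m.+1], so one of them is at most
    [uphalf m]. For odd [m] either one is strictly smaller or both are equal to [uphalf m]; in both
    cases there are two exits. *)
Lemma walk_bound_rate (m j : nat) : (j < m)%N ->
  walk_bound R m (uphalf m) j.+1 <= contraction_rate R m.
Proof.
move=> jm; rewrite /walk_bound /contraction_rate.
have p0 : 0 < 2 ^+ uphalf m :> R by rewrite exprn_gt0.
set e := (_ + _)%N.
have e_ge : ((if odd m then 2 else 1) <= e)%N.
  by rewrite /e /exits; case: ifP => om; lia.
have -> : 1 - e%:R / 2 ^+ uphalf m = (2 ^+ uphalf m - e%:R) / 2 ^+ uphalf m :> R.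
  by field; rewrite lt0r_neq0.
by move: e_ge; case: ifP => _; rewrite -(ler_nat R) => e_ge;
  rewrite ler_pM2r ?invr_gt0// lerD2l lerN2.
Qed.

Lemma contraction_rate_itv (m : nat) : (2 <= m)%N ->
  0 <= contraction_rate R m < 1.
Proof.
move=> m2; rewrite /contraction_rate.
have p0 : 0 < 2 ^+ uphalf m :> R by rewrite exprn_gt0.
have p2 : 2 <= 2 ^+ uphalf m :> R.
  rewrite -natrX ler_nat -{1}(expn1 2) leq_exp2l//; lia.
by case: ifP => _; rewrite divr_ge0 ?ltr_pdivrMr//=; lra.
Qed.

(** The ordinal [j], counted from 0, stands for the site [j.+1]. A missing neighbour adds 0 to the
    sum, which the nonnegative bound at the sites 0 and [m.+1] dominates. *)
Lemma walk_bound_iter (m : nat) (c : nat -> 'I_m -> R) :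
    (forall j, c 0 j <= 1) ->
    (forall k j, c k.+1 j <= 2^-1 * \sum_(i < m | neighbours i j) c k i) ->
  forall k j, (k <= m)%N -> c k j <= walk_bound R m k j.+1.
Proof.
move=> c0 cS; elim=> [|k IH] j km.
  apply: le_trans (c0 j) _; rewrite /walk_bound /exits.
  have -> : (j.+1 <= 0)%N = false by [].
  have -> : (m.+1 - j.+1 <= 0)%N = false by have := ltn_ord j; lia.
  by rewrite !ltn0 mul0r subr0.
apply: le_trans (cS k j) _; apply: le_trans (walk_bound_step k (ltn_ord j)).
rewrite ler_pM2l ?invr_gt0//.
have : \sum_(i < m | neighbours i j) c k i <=
    \sum_(i < m | neighbours i j) walk_bound R m k i.+1.
  by apply: ler_sum => i _; exact: IH (ltnW km).
move=> /le_trans; apply.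
rewrite (sum_neighbours (fun i => walk_bound R m k i.+1)).
have [b0 bm] := walk_bound_border (ltnW km).
apply: lerD.
  by case: (ltnP 0 j) => [j0|]; [rewrite prednK | rewrite leqn0 => /eqP->].
by case: (ltnP j.+1 m) => // jm; rewrite (_ : j.+2 = m.+1)//; have := ltn_ord j; lia.
Qed.

End Walk.

(** * Banach's fixed point theorem *)

Section Metric.
Context {R : realType}.

(** Picard iteration, with completeness in the form of Cauchy filters that [cplus_complete]
    provides. *)
Lemma contraction_fixpoint (X : metricType R) (S : X -> X) (q : R) (x0 : X) :
    (forall F : set_system X, ProperFilter F -> cauchy F ->
       exists x : X, F --> x) ->
    0 <= q < 1 -> (forall x y, mdist (S x) (S y) <= q * mdist x y) ->
  exists x, S x = x.
Proof.
move=> X_complete /andP[q0 q1] S_lip.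
(* [D] solves [mdist x0 (S x0) + q * D = D], so the bound on the distance from [x0] reproduces
   itself along the orbit. *)
pose u n := iter n S x0; pose D := mdist x0 (S x0) / (1 - q).
have D0 : 0 <= D by rewrite divr_ge0 ?mdist_ge0// subr_ge0 ltW.
have uD k : mdist x0 (u k) <= D.
  elim: k => [|k IH]; first by rewrite mdistxx.
  apply: le_trans (metric_triangle _ (S x0) _) _.
  apply: le_trans (lerD (lexx _) (le_trans (S_lip _ _) (ler_wpM2l q0 IH))) _.
  rewrite /D le_eqVlt; apply/orP; left; apply/eqP; field.
  by rewrite subr_eq0 eq_sym lt_eqF.
have u_cauchy n k : mdist (u n) (u (n + k)%N) <= q ^+ n * D.
  elim: n => [|n IH]; first by rewrite expr0 mul1r add0n; exact: uD.
  by rewrite exprS -mulrA; apply: le_trans (S_lip _ _) (ler_wpM2l q0 IH).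
have [|x ux] := X_complete (u @ \oo) _.
  apply/cauchyP => e e0.
  have qD : q ^+ n * D @[n --> \oo] --> 0.
    by rewrite -[X in _ --> X](mul0r D); apply: cvgMl;
      apply: cvg_expr; rewrite ger0_norm.
  have /cvgr0Pnorm_lt/(_ e e0)[n _ nD] := qD.
  exists (u n), n => // k /= nk; rewrite ballEmdist/=.
  rewrite -(subnKC nk); apply: le_lt_trans (u_cauchy _ _) _.
  by apply: le_lt_trans (nD n (leqnn n)); exact: ler_norm.
(* For large [n] both [S x] and [x] lie within [e / 2] of [u n.+1]. *)
exists x; apply: mdist_positivity; apply/eqP.
rewrite eq_le mdist_ge0 andbT; apply/ler_addgt0Pl => e e0; rewrite addr0.
have [n _ nu] := ux _ (nbhsx_ballx x _ (divr_gt0 e0 (ltr0n _ 2))).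
have ux_lt k : (n <= k)%N -> mdist x (u k) < e / 2.
  by move=> nk; have := nu k nk; rewrite /= ballEmdist.
apply: le_trans (metric_triangle _ (u n.+1) _) _.
rewrite metric_sym (metric_sym _ x) [leRHS]splitr lerD//; last exact/ltW/ux_lt.
rewrite metric_sym; apply: le_trans (S_lip _ _) _.
rewrite (le_trans _ (ltW (ux_lt n (leqnn n))))// ler_piMl ?mdist_ge0//.
exact: ltW.
Qed.

End Metric.

(** * Completeness of the space of positive continuous vectors *)

Section CplusMetric.
Context {R : realType} {m : nat} {a b : 'I_m -> R}.

(** Building elements from their logarithms makes positivity automatic; limits, images under the map
    and the start of the iteration arise in this way. *)
Lemma cplus_exp (L : forall j : 'I_m, nbr_dom a b j -> R) :
    (forall j, continuous (L j)) ->
  exists f : Cplus a b, forall j x, f j x = expR (L j x).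
Proof.
move=> cL.
have L0 j (x : nbr_dom a b j) : 0 < expR (L j x) by exact: expR_gt0.
have cexpL j : continuous (fun x : nbr_dom a b j => expR (L j x)).
  by move=> x; apply: continuous_comp; [exact: cL | exact: continuous_expR].
by exists (MkCplus L0 cexpL).
Qed.

Lemma cplus_ln_continuous (f : Cplus a b) (j : 'I_m) :
  continuous (fun x : nbr_dom a b j => ln (f j x)).
Proof.
move=> x; apply: continuous_comp; first exact: cplus_continuous.
by apply: continuous_ln; exact: cplus_gt0.
Qed.

(** In terms of logarithms the distance is uniform, so the classical argument applies: pointwise
    limits exist, the convergence is uniform and the limit is continuous. *)
Lemma cplus_complete (F : set_system (Cplus a b)) :
  ProperFilter F -> cauchy F -> exists f : Cplus a b, F --> f.
Proof.
move=> PF /cauchyP F_cauchy.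
have near_center e : 0 < e -> exists f0 : Cplus a b,
    F [set f | forall j (x : nbr_dom a b j), `|ln (f j x) - ln (f0 j x)| < e].
  move=> e0; have [f0 Ff0] := F_cauchy e e0.
  exists f0; apply: filterS Ff0 => f; rewrite ballEmdist/= => f0f j x.
  rewrite distrC -ln_div ?posrE ?cplus_gt0//.
  by apply: le_lt_trans f0f; exact: le_cplus_dist.
pose L j (x : nbr_dom a b j) := lim ((fun f : Cplus a b => ln (f j x)) @ F).
have cvgL j x : (fun f : Cplus a b => ln (f j x)) @ F --> L j x.
  apply: cauchy_cvg; apply/cauchyP => e e0.
  have [f0 Ff0] := near_center _ e0.
  exists (ln (f0 j x)).
  suff : F [set f : Cplus a b | ball (ln (f0 j x)) e (ln (f j x))] by [].
  apply: filterS Ff0 => f /= /(_ j x) f0f.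
  by rewrite /ball/= distrC.
(* Passing to the limit along [F] makes the same [f0] close to [L] uniformly in [x]; the inequality
   becomes weak. *)
have L_near e : 0 < e -> exists f0 : Cplus a b,
    F [set f | forall j (x : nbr_dom a b j), `|ln (f j x) - ln (f0 j x)| < e] /\
    forall j x, `|L j x - ln (f0 j x)| <= e.
  move=> e0; have [f0 Ff0] := near_center _ e0.
  exists f0; split=> // j x.
  have dL : (fun f : Cplus a b => `|ln (f j x) - ln (f0 j x)|) @ F -->
      `|L j x - ln (f0 j x)|.
    by apply: cvg_norm; apply: cvgB; [exact: cvgL | exact: cvg_cst].
  by apply: (cvgr_to_le dL); apply: filterS Ff0 => f /(_ j x)/ltW.
have cL j : continuous (@L j).
  move=> x; apply/(@cvgrPdist_lt _ _ _ _ (nbhs_filter x)) => e e0.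
  have e4 : 0 < e / 4 by rewrite divr_gt0.
  have [f0 [_ Lf0]] := L_near _ e4.
  have f0x : \forall y \near x, `|ln (f0 j x) - ln (f0 j y)| < e / 4.
    have /(@cvgrPdist_lt _ _ _ _ (nbhs_filter x)) := @cplus_ln_continuous f0 j x.
    exact.
  near=> y.
  have f0xy : `|ln (f0 j x) - ln (f0 j y)| < e / 4 by near: y.
  have := Lf0 j x; have := Lf0 j y; move: f0xy.
  rewrite !ltr_norml !ler_norml; lra.
have [f fE] := cplus_exp cL.
exists f; apply/cvg_ballP => e e0.
have e4 : 0 < e / 4 by rewrite divr_gt0.
have [f0 [Ff0 Lf0]] := L_near _ e4.
apply: filterS Ff0 => g gf0; rewrite ballEmdist/=.
apply: (@le_lt_trans _ _ (e / 2)); last by lra.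
apply: cplus_dist_le => [|j x]; first by rewrite divr_ge0// ltW.
rewrite ln_div ?posrE ?cplus_gt0// fE expRK.
have := Lf0 j x; have := gf0 j x.
rewrite ltr_norml !ler_norml; lra.
Unshelve. all: by end_near. Qed.

End CplusMetric.

(** * Harmonic measure of the complement of an interval *)

Section SzegoDensity.
Context {R : realType}.
Implicit Types a b x t : R.

(* The density of the harmonic measure, seen from x, of the complement of
   [a, b]. *)
Definition szego_density a b x t : R :=
  Num.sqrt ((x - a) * (x - b)) / (pi * `|t - x|) * eta_density a b t.

Lemma notin_itvcc a b x : a < b -> x \notin `[a, b] -> x < a \/ b < x.
Proof.
move=> ab; rewrite in_itv/= negb_and -!ltNge => /orP[]; [by left|by right].
Qed.

Lemma notin_itvcc_gt0 a b x : a < b -> x \notin `[a, b] ->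
  0 < (x - a) * (x - b).
Proof.
by move=> ab /(notin_itvcc ab)[xa|bx]; [rewrite nmulr_rgt0|rewrite pmulr_rgt0]; lra.
Qed.

Lemma szego_density_ge0 a b x t : 0 <= szego_density a b x t.
Proof.
rewrite /szego_density /eta_density mulr_ge0 ?invr_ge0 ?sqrtr_ge0//.
by rewrite divr_ge0 ?sqrtr_ge0// mulr_ge0// pi_ge0.
Qed.

(** The distribution function of the harmonic measure, rising from 0 at [a] towards 1 at [b]. At
    [t = b] itself the division by zero yields 0, so it serves only inside the interval. *)
Definition szego_primitive a b x t : R :=
  2 / pi * atan (Num.sqrt ((x - b) / (x - a) * ((t - a) / (b - t)))).

Lemma is_derive_szego_primitive a b x t : a < t < b -> x \notin `[a, b] ->
  is_derive t (1 : R) (szego_primitive a b x) (szego_density a b x t).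
Proof.
move=> /andP[at_ tb] xab; have ab : a < b by exact: lt_trans tb.
have bt : 0 < b - t by lra.
have ta : 0 < t - a by lra.
have bt0 : b - t != 0 by lra.
have xa0 : x - a != 0 by case: (notin_itvcc ab xab) => ?; lra.
have xt0 : x - t != 0 by case: (notin_itvcc ab xab) => ?; lra.
have ba0 : b - a != 0 by lra.
have pi0 : pi != 0 :> R by rewrite gt_eqF// pi_gt0.
have k0 : 0 < (x - b) / (x - a).
  have := notin_itvcc_gt0 ab xab.
  rewrite (_ : (x - a) * (x - b) = (x - b) / (x - a) * (x - a) ^+ 2); last by field.
  by rewrite pmulr_lgt0// exprn_even_gt0.
set r := fun t => (x - b) / (x - a) * ((t - a) / (b - t)).
have r0 : 0 < r t by rewrite mulr_gt0// divr_gt0; lra.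
have dr : is_derive t 1 r ((x - b) / (x - a) * ((b - a) / (b - t) ^+ 2)).
  apply: is_derive_eq.
  rewrite /GRing.scale/=; field; exact/andP.
have dsr := is_derive1_comp (is_derive1_sqrt r0) dr.
have dasr := @is_derive1_comp _ _ (Num.sqrt \o r) _ _ _ (is_derive1_atan _) dsr.
apply: is_derive_eq.
rewrite sqr_sqrtr ?ltW// /szego_density /eta_density.
set s := Num.sqrt ((x - a) * (x - b)); set q := Num.sqrt ((b - t) * (t - a)).
have s0 : 0 < s by rewrite sqrtr_gt0 notin_itvcc_gt0.
have q0 : 0 < q by rewrite sqrtr_gt0 mulr_gt0.
have s2 : s ^+ 2 = (x - a) * (x - b) by rewrite sqr_sqrtr// ltW// notin_itvcc_gt0.
have q2 : q ^+ 2 = (b - t) * (t - a) by rewrite sqr_sqrtr// ltW// mulr_gt0.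
(* With the root of [r t] rational in [s] and [q], [field] can conclude once the signs are known. *)
have sr : Num.sqrt (r t) = s * q / (`|x - a| * (b - t)).
  apply/eqP; rewrite -(@eqrXn2 _ 2%N) ?sqrtr_ge0//; last first.
    by rewrite divr_ge0// mulr_ge0// ltW.
  rewrite sqr_sqrtr ?ltW// expr_div_n !exprMn s2 q2 real_normK ?num_real// /r.
  by apply/eqP; field; rewrite bt0.
(* The chain rule puts [s] into the denominator, whereas the density has it in the numerator. *)
have sE : s = (x - a) * (x - b) / s by rewrite -s2 expr2 mulfK// gt_eqF.
have s_neq0 : s != 0 by rewrite gt_eqF.
have q_neq0 : q != 0 by rewrite gt_eqF.
rewrite sr [in RHS]sE /r /GRing.scale/=.
have -> : 1 + (x - b) / (x - a) * ((t - a) / (b - t)) =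
    (b - a) * (x - t) / ((b - t) * (x - a)) by field; rewrite ?bt0 ?xa0.
have tx0 : t - x != 0 by rewrite -opprB oppr_eq0.
move: (pi : R) pi0 => p p0.
case: (notin_itvcc ab xab) => x_lt.
  rewrite (ltr0_norm (_ : x - a < 0)); last by lra.
  rewrite (gtr0_norm (_ : 0 < t - x)); last by lra.
  by field; rewrite ?q_neq0 ?tx0 ?p0 ?s_neq0 ?bt0 ?xa0 ?xt0 ?ba0.
rewrite (gtr0_norm (_ : 0 < x - a)); last by lra.
rewrite (ltr0_norm (_ : t - x < 0)); last by lra.
by field; rewrite ?q_neq0 ?tx0 ?p0 ?s_neq0 ?bt0 ?xa0 ?xt0 ?ba0.
Qed.

Lemma szego_primitive_itv a b x t : a < t < b -> x \notin `[a, b] ->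
  0 <= szego_primitive a b x t <= 1.
Proof.
move=> /andP[at_ tb] xab.
have pi0 := pi_gt0 R.
have := le_atan (sqrtr_ge0 ((x - b) / (x - a) * ((t - a) / (b - t)))).
have := atan_ltpi2 (Num.sqrt ((x - b) / (x - a) * ((t - a) / (b - t)))).
rewrite /szego_primitive atan0; set y := atan _ => y1 y0.
apply/andP; split; first by rewrite mulr_ge0// divr_ge0// ltW.
rewrite mulrAC ler_pdivrMr// mul1r; lra.
Qed.

Lemma eta_density_continuous a b t : a < t < b ->
  {for t, continuous (eta_density a b)}.
Proof.
move=> /andP[at_ tb]; apply: continuousV.
  by rewrite gt_eqF// sqrtr_gt0 mulr_gt0// subr_gt0.
apply: (@continuous_comp _ _ _ (fun t => (b - t) * (t - a)) Num.sqrt);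
  last exact: sqrt_continuous.
by apply: continuousM; apply: continuousB => //; exact: cvg_cst.
Qed.

Lemma szego_density_continuous a b x t : a < t < b -> x \notin `[a, b] ->
  {for t, continuous (szego_density a b x)}.
Proof.
move=> atb xab; have /andP[at_ tb] := atb.
apply: continuousM; last exact: eta_density_continuous.
apply: continuousM; first exact: cvg_cst.
apply: continuousV.
  rewrite mulf_neq0 ?gt_eqF ?pi_gt0// normr_gt0 subr_eq0.
  by case: (notin_itvcc (lt_trans at_ tb) xab) => ?; lra.
apply: continuousM; first exact: cvg_cst.
apply: (@continuous_comp _ _ _ (fun t => t - x) (fun y : R => `|y|));
  last exact: norm_continuous.
by apply: continuousB => //; exact: cvg_cst.
Qed.

(** The densities blow up near the endpoints, so continuity is available only inside; two points do
    not affect measurability. *)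
Lemma measurable_continuous_itvoo (h : R -> R) a b :
  (forall t, a < t < b -> {for t, continuous h}) -> measurable_fun `[a, b] h.
Proof.
move=> ch; apply: (@measurable_fun_itv_cc _ _ _ false true).
apply: open_continuous_measurable_fun.
  exact: interval_open.
by move=> t; rewrite inE/= in_itv/= => /ch.
Qed.

Lemma measurable_szego_density a b x : x \notin `[a, b] ->
  measurable_fun `[a, b] (szego_density a b x).
Proof.
by move=> xab; apply: measurable_continuous_itvoo => t atb;
  exact: szego_density_continuous.
Qed.

Lemma measurable_eta_density a b : measurable_fun `[a, b] (eta_density a b).
Proof. by apply: measurable_continuous_itvoo => t; exact: eta_density_continuous. Qed.

(** The fundamental theorem of calculus applies on the compact intervals [A n] inside []a, b[],
    where the primitive stays between 0 and 1; monotone convergence carries the bound to the whole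
    interval. *)
Lemma integral_szego_density_le1 a b x : a < b -> x \notin `[a, b] ->
  (\int[lebesgue_measure]_(t in `[a, b]) (szego_density a b x t)%:E <= 1)%E.
Proof.
move=> ab xab.
(* The shift by 3 makes [A n] nondegenerate already for [n = 0]. *)
pose d n : R := (b - a) / n.+3%:R.
have d0 n : 0 < d n by rewrite divr_gt0// subr_gt0.
have dd n : d n *+ 2 < b - a.
  rewrite -mulr_natr /d mulrAC ltr_pdivrMr// ltr_pM2l ?subr_gt0// ltr_nat.
  by lia.
have d_decr n k : (n <= k)%N -> d k <= d n.
  move=> nk; rewrite ler_pM2l ?subr_gt0// lef_pV2 ?posrE// ler_nat; lia.
pose A n : set R := `[a + d n, b - d n]%classic.
have A_itv n t : A n t -> a < t < b.
  by rewrite /A/= in_itv/= => /andP[? ?]; have := d0 n; lra.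
have bigcupA : \bigcup_n A n = `]a, b[%classic.
  apply/seteqP; split => [t [n _ /A_itv]|t]; rewrite /= in_itv//=.
  move=> /andP[at_ tb].
  have e0 : 0 < Num.min (t - a) (b - t) / (b - a).
    by rewrite divr_gt0 ?subr_gt0// lt_min !subr_gt0 at_.
  have [n] := ltr_add_invr e0; rewrite add0r ltr_pdivlMr ?subr_gt0// => nt.
  have dn : d n < Num.min (t - a) (b - t).
    apply: le_lt_trans nt; rewrite [leRHS]mulrC ler_pM2l ?subr_gt0//.
    by rewrite lef_pV2 ?posrE// ler_nat; lia.
  exists n => //; rewrite /A/= in_itv/=; move: dn; rewrite lt_min => /andP[].
  lra.
have int_A n :
    (\int[lebesgue_measure]_(t in A n) (szego_density a b x t)%:E <= 1)%E.
  have der t : t \in `]a, b[ -> is_derive t (1 : R) (szego_primitive a b x)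
      (szego_density a b x t).
    by rewrite in_itv/= => atb; exact: is_derive_szego_primitive.
  have in_ab t : t \in `[a + d n, b - d n] -> t \in `]a, b[.
    by rewrite in_itv/= => /andP[? ?]; rewrite in_itv/=; have := d0 n; lra.
  have dn : a + d n < b - d n by have := dd n; rewrite mulr2n; lra.
  have cP t : t \in `[a + d n, b - d n] ->
      {for t, continuous (szego_primitive a b x)}.
    move=> /in_ab/der dt.
    apply/differentiable_continuous/derivable1_diffP; exact: ex_derive.
  rewrite (@continuous_FTC2 _ _ (szego_primitive a b x))//.
  - have pa : a < a + d n < b by have := d0 n; lra.
    have pb : a < b - d n < b by have := d0 n; lra.
    have /andP[pa0 _] := szego_primitive_itv pa xab.
    have /andP[_ pb1] := szego_primitive_itv pb xab.
    by rewrite -EFinB lee_fin; lra.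
  - apply: continuous_in_subspaceT => t; rewrite inE/= => /in_ab.
    by rewrite in_itv/= => atb; exact: szego_density_continuous.
  - split.
    + move=> t tA; have dt := der t (in_ab t (subset_itv_oo_cc tA)).
      exact: ex_derive.
    + by apply: cvg_at_right_filter; apply: cP; rewrite in_itv/= lexx ltW.
    + by apply: cvg_at_left_filter; apply: cP; rewrite in_itv/= lexx ltW.
  - move=> t tA; have dt := der t (in_ab t (subset_itv_oo_cc tA)).
    by rewrite derive1E derive_val.
have md : measurable_fun `[a, b] (EFin \o szego_density a b x).
  by apply/measurable_EFinP; exact: measurable_szego_density.
rewrite integral_itv_bndoo; last first.
  by apply: (measurable_funS _ _ md) => // t; exact: subset_itv_oo_cc.
rewrite -bigcupA.
apply: (@cvge_to_le _ \oo _ _ _ _ _ (ge0_nondecreasing_set_cvg_integral _ _ _ _)).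
- move=> n k nk; apply/subsetPset => t; rewrite /A/= !in_itv/=.
  by have := d_decr _ _ nk; lra.
- by move=> n; exact: measurable_itv.
- move=> n; apply: (measurable_funS _ _ md) => //.
  by move=> t /A_itv; rewrite /= in_itv/= => /andP[? ?]; rewrite !ltW.
- by move=> n t _; rewrite lee_fin szego_density_ge0.
- exact: nearW.
Qed.

Lemma integrable_szego_density a b x : a < b -> x \notin `[a, b] ->
  lebesgue_measure.-integrable `[a, b] (EFin \o szego_density a b x).
Proof.
move=> ab xab; apply/integrableP; split.
  by apply/measurable_EFinP; exact: measurable_szego_density.
under eq_integral do rewrite /= ger0_norm ?szego_density_ge0//.
exact: le_lt_trans (integral_szego_density_le1 ab xab) (ltry _).
Qed.

Lemma Rintegral_szego_density_le1 a b x : a < b -> x \notin `[a, b] ->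
  (\int[lebesgue_measure]_(t in `[a, b]) szego_density a b x t)%R <= 1.
Proof.
move=> ab xab; rewrite -lee_fin /Rintegral fineK.
  exact: integral_szego_density_le1.
by apply: integrable_fin_num => //; exact: integrable_szego_density.
Qed.

End SzegoDensity.

(** * Logarithm of the Szegő function and its dependence on the weight *)

Section LogSzego.
Context {R : realType}.
Implicit Types (a b x t c : R) (w v P Q g h : R -> R).

Notation mu := (@lebesgue_measure R).

(** The exponent of [szego] at a real [x] off [a, b]. On either side the root and [t - x] have
    opposite signs; hence the minus sign and the absolute value. *)
Definition log_szego a b v x : R :=
  - (2^-1 * (Num.sqrt ((x - a) * (x - b)) / pi *
     \int[mu]_(t in `[a, b]) (ln (v t) * eta_density a b t * `|t - x|^-1))).

Lemma integrable_mul_continuous g h a b :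
    mu.-integrable `[a, b] (EFin \o g) -> {within `[a, b], continuous h} ->
  mu.-integrable `[a, b] (EFin \o (fun t => g t * h t)).
Proof.
move=> ig ch; apply: (@eq_integrable _ _ _ mu _ _ ((EFin \o g) \* (EFin \o h))%E) => //.
apply: integrableMl => //.
  by apply: subspace_continuous_measurable_fun => //; exact: measurable_itv.
have /compact_bounded[M [Mr hM]] := continuous_compact ch (@segment_compact _ a b).
by exists M; split=> // y My t tab; apply: hM => //; exists t.
Qed.

Lemma dist_neq0 a b x t : x \notin `[a, b] -> t \in `[a, b] -> t - x != 0.
Proof. by move=> xab tab; rewrite subr_eq0; apply: contraNneq xab => <-. Qed.

Lemma within_continuous_subr a b x :
  {within `[a, b], continuous (fun t => t - x)}.
Proof.
apply: continuous_subspaceT => t.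
by apply: continuousB => //; exact: cvg_cst.
Qed.

Lemma within_continuous_inv h (A : set R) : (forall t, A t -> h t != 0) ->
  {within A, continuous h} -> {within A, continuous (fun t => (h t)^-1)}.
Proof.
move=> h0 /subspace_continuousP ch; apply/subspace_continuousP => t At.
by apply: cvgV; [exact: h0 | exact: ch].
Qed.

Lemma within_continuous_norm h (A : set R) :
  {within A, continuous h} -> {within A, continuous (fun t => `|h t|)}.
Proof.
move=> /subspace_continuousP ch; apply/subspace_continuousP => t At.
by apply: cvg_norm; exact: ch.
Qed.

Lemma within_continuousMl h (A : set R) c :
  {within A, continuous h} -> {within A, continuous (fun t => c * h t)}.
Proof.
move=> /subspace_continuousP ch; apply/subspace_continuousP => t At.
by apply: cvgM; [exact: cvg_cst | exact: ch].
Qed.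

(** Inherited from [szego_density] at the outside point [b + 1], from which it differs by a factor
    continuous on [a, b]. *)
Lemma integrable_eta_density a b : a < b ->
  mu.-integrable `[a, b] (EFin \o eta_density a b).
Proof.
move=> ab; pose x := b + 1; have xab : x \notin `[a, b].
  by rewrite in_itv/= /x negb_and -!ltNge; apply/orP; right; lra.
have s0 : 0 < Num.sqrt ((x - a) * (x - b)) by rewrite sqrtr_gt0 notin_itvcc_gt0.
have := integrable_mul_continuous (integrable_szego_density ab xab)
  (h := fun t => pi / Num.sqrt ((x - a) * (x - b)) * `|t - x|).
set s := Num.sqrt _ in s0 *.
move=> /(_ _)/(@eq_integrable _ _ _ mu _ _ _ (EFin \o eta_density a b)); apply => //.
  move=> t; rewrite inE/= => tab; congr EFin; rewrite /szego_density -/s.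
  have := dist_neq0 xab tab; rewrite -normr_eq0; move: `|_| => y y0.
  have := pi_gt0 R; move: (pi : R) => p p0.
  by field; rewrite y0 !gt_eqF.
apply: within_continuousMl.
by apply: within_continuous_norm; exact: within_continuous_subr.
Qed.

(** Where [w <= 0], [lne] is [-oo] but [ln] is 0: this integrand is [fine] of the extended one,
    hence measurable and no larger in absolute value. *)
Lemma integrable_ln_eta w a b : eta_integrable a b (fun t => lne (w t)%:E) ->
  mu.-integrable `[a, b] (EFin \o (fun t => ln (w t) * eta_density a b t)).
Proof.
move=> iw.
have E t : ln (w t) * eta_density a b t =
    fine (lne (w t)%:E * (eta_density a b t)%:E)%E.
  rewrite /=; case: ifPn => [w0|_//]; rewrite ln0// mul0r.
  have d0 : 0 <= eta_density a b t by rewrite invr_ge0 sqrtr_ge0.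
  by rewrite mulNyr; move: d0; rewrite le_eqVlt => /predU1P[<-|d0];
    [rewrite sgr0 mul0e | rewrite gtr0_sg// mul1e].
apply: (le_integrable _ _ _ iw) => //.
  apply/measurable_EFinP.
  rewrite (_ : (fun _ => _) = fine \o (fun t => lne (w t)%:E * (eta_density a b t)%:E)%E);
    last by apply/funext => t; exact: E.
  by apply: measurableT_comp; [exact: fine_measurable | case/integrableP : iw].
move=> t _; rewrite [(EFin \o _) t]/= E; by case: (_ * _)%E => [r| |]//=; rewrite normr0 leey.
Qed.

(** Measurability is given only for the product of [lne w] with the density. The set where this
    product exceeds [-oo] is that where [w > 0], up to points of zero density. *)
Lemma measurable_pos_eta w a b : eta_integrable a b (fun t => lne (w t)%:E) ->
  measurable_fun `[a, b] (fun t => (0 < w t)%R%:R * eta_density a b t).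
Proof.
move=> /integrableP[mw _].
pose E t := (lne (w t)%:E * (eta_density a b t)%:E)%E.
rewrite (_ : (fun _ => _) =
    fun t => if (-oo < E t)%E then eta_density a b t else 0); last first.
  apply/funext => t; rewrite /E /=.
  have d0 : 0 <= eta_density a b t by rewrite invr_ge0 sqrtr_ge0.
  case: ltP => w0; first by rewrite -EFinM ltNyr mul1r.
  rewrite mul0r mulNyr; move: d0; rewrite le_eqVlt => /predU1P[<-|d0].
    by case: ifP.
  by rewrite gtr0_sg// mul1e ltxx.
apply: measurable_fun_if => //.
- by apply: measurable_fun_lte => //; exact: measurable_cst.
- by apply: (measurable_funS _ _ (@measurable_eta_density R a b)) => //;
    exact: subIsetl.
Qed.

(* As [ln] is 0 on nonpositive reals, the factor [p] also drops out when
   [y <= 0]. *)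
Lemma ln_div_pos (y p : R) : 0 < p -> ln (y / p) = ln y - (0 < y)%R%:R * ln p.
Proof.
move=> p0; case: ltP => y0; first by rewrite mul1r ln_div.
by rewrite mul0r subr0 !ln0// pmulr_lle0// invr_gt0.
Qed.

Lemma integrable_pos_eta w a b : a < b ->
    eta_integrable a b (fun t => lne (w t)%:E) ->
  mu.-integrable `[a, b] (EFin \o (fun t => (0 < w t)%R%:R * eta_density a b t)).
Proof.
move=> ab iw; apply: (le_integrable _ _ _ (integrable_eta_density ab)) => //.
  by apply/measurable_EFinP; exact: measurable_pos_eta.
move=> t _; rewrite /= lee_fin normrM ler_piMl//.
by case: ltP => _; rewrite ?normr0 ?normr1.
Qed.

Lemma within_continuous_ln P (A : set R) : (forall t, 0 < P t) ->
  {within A, continuous P} -> {within A, continuous (fun t => ln (P t))}.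
Proof.
move=> P0 cP t; apply: continuous_comp; first exact: cP.
exact: continuous_ln.
Qed.

Lemma integrable_ln_div_eta w P a b : a < b ->
    eta_integrable a b (fun t => lne (w t)%:E) ->
    (forall t, 0 < P t) -> {within `[a, b], continuous P} ->
  mu.-integrable `[a, b] (EFin \o (fun t => ln (w t / P t) * eta_density a b t)).
Proof.
move=> ab iw P0 cP.
have i1 := integrable_ln_eta iw.
have i2 := integrable_mul_continuous (integrable_pos_eta ab iw)
  (within_continuous_ln P0 cP).
apply: (eq_integrable _ _ _ _ (integrableB _ i1 i2)) => // t _ /=.
by rewrite ln_div_pos// -EFinB; congr EFin; ring.
Qed.

Lemma log_szegoE a b v x : x \notin `[a, b] ->
    mu.-integrable `[a, b] (EFin \o (fun t => ln (v t) * eta_density a b t)) ->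
  log_szego a b v x =
    - (2^-1 * \int[mu]_(t in `[a, b]) (ln (v t) * szego_density a b x t)).
Proof.
move=> xab iv; rewrite /log_szego -RintegralZl//; last first.
  apply: integrable_mul_continuous => //.
  apply: within_continuous_inv.
    by move=> t /= tab; rewrite normr_eq0 (dist_neq0 xab).
  by apply: within_continuous_norm; exact: within_continuous_subr.
congr (- (_ * _)); apply: eq_Rintegral => t _; rewrite /szego_density invfM.
by ring.
Qed.

(** The weight [w] cancels in the difference, which becomes half the average of [ln (P / Q)] against
    a measure of mass at most 1. *)
Lemma log_szego_le w P Q a b x c : a < b -> x \notin `[a, b] ->
    eta_integrable a b (fun t => lne (w t)%:E) ->
    (forall t, 0 < P t) -> {within `[a, b], continuous P} ->
    (forall t, 0 < Q t) -> {within `[a, b], continuous Q} ->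
    (forall t, t \in `[a, b] -> `|ln (P t / Q t)| <= c) ->
  `|log_szego a b (fun t => w t / P t) x - log_szego a b (fun t => w t / Q t) x|
    <= 2^-1 * c.
Proof.
move=> ab xab iw P0 cP Q0 cQ PQ.
have iP := integrable_ln_div_eta ab iw P0 cP.
have iQ := integrable_ln_div_eta ab iw Q0 cQ.
have ch : {within `[a, b], continuous (fun t =>
    Num.sqrt ((x - a) * (x - b)) / pi * `|t - x|^-1)}.
  apply: within_continuousMl.
  apply: within_continuous_inv.
    by move=> s /= sab; rewrite normr_eq0 (dist_neq0 xab).
  by apply: within_continuous_norm; exact: within_continuous_subr.
have integrable_density v :
    mu.-integrable `[a, b] (EFin \o (fun t => ln (v t) * eta_density a b t)) ->
    mu.-integrable `[a, b] (EFin \o (fun t => ln (v t) * szego_density a b x t)).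
  move=> iv; apply: (eq_integrable _ _ _ _ (integrable_mul_continuous iv ch)) => // t _ /=.
  by rewrite /szego_density invfM; congr EFin; ring.
rewrite !log_szegoE// -opprD normrN -mulrN -mulrDr normrM gtr0_norm//.
rewrite ler_pM2l// -RintegralB//; [|exact: integrable_density..].
have c0 : 0 <= c.
  by apply: (le_trans _ (PQ a _)); rewrite // in_itv/= lexx ltW.
have iPQ : mu.-integrable `[a, b] (EFin \o (fun t =>
    ln (w t / P t) * szego_density a b x t - ln (w t / Q t) * szego_density a b x t)).
  by apply: (integrableB _ (integrable_density _ iP) (integrable_density _ iQ)).
apply: le_trans (le_normr_Rintegral _ _) _ => //.
have id := integrable_szego_density ab xab.
apply: (@le_trans _ _ (\int[mu]_(t in `[a, b]) (c * szego_density a b x t))).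
  apply: le_Rintegral => //.
  - exact: integrable_norm.
  - exact: (integrableZl _ _ id).
  move=> t tab; rewrite -mulrBl normrM (ger0_norm (szego_density_ge0 _ _ _ _)).
  apply: ler_wpM2r; first exact: szego_density_ge0.
  (* Where [w t <= 0] both logarithms are 0 and [0 <= c] is what remains to be used. *)
  rewrite !ln_div_pos//; have := PQ t tab; rewrite ln_div ?posrE//.
  by case: ltP => _ h; rewrite ?mul1r ?mul0r; move: h; rewrite !ler_norml; lra.
by rewrite RintegralZl// ler_piMr// Rintegral_szego_density_le1.
Qed.

End LogSzego.

(** * The Szegő function on the real line off its interval *)

Section SzegoReal.
Context {R : realType}.
Implicit Types (a b x t c : R) (v : R -> R).
Local Open Scope complex_scope.

Notation mu := (@lebesgue_measure R).

Lemma sqrtc_neg (y : R) : y < 0 -> sqrtc y%:C = 0 +i* Num.sqrt (- y).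
Proof.
move=> y0; rewrite /sqrtc /= eqxx mul1r expr0n/= addr0 sqrtr_sqr ltr0_norm//.
by congr (_ +i* _); [rewrite addNr mul0r sqrtr0 | congr Num.sqrt; field].
Qed.

Lemma sqrtc_ge0_real (y : R) : 0 <= y -> sqrtc y%:C = (Num.sqrt y)%:C.
Proof. by move=> y0; rewrite sqrtc_sqrtr// lecR. Qed.

(** Left of [a] both radicands are negative, and the product of two imaginary roots brings the
    sign. *)
Lemma sqrt_branch_real a b x : a < b -> x \notin `[a, b] ->
  sqrt_branch a b x%:C = ((-1) ^+ (x < a)%R * Num.sqrt ((x - a) * (x - b)))%:C.
Proof.
move=> ab xab; rewrite /sqrt_branch -!rmorphB.
case: (notin_itvcc ab xab) => x_lt.
  rewrite x_lt expr1 !sqrtc_neg; [|lra|lra].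
  rewrite -[(x - a) * (x - b)]mulrNN !opprB sqrtrM; last by lra.
  by simpc; rewrite [Num.sqrt (b - x) * _]mulrC.
rewrite ltNge (ltW (lt_trans ab x_lt)) expr0 mul1r !sqrtc_ge0_real; [|lra|lra].
by rewrite sqrtrM; [rewrite -rmorphM/= mulrC | lra].
Qed.

Lemma cexp_real (y : R) : cexp y%:C = (expR y)%:C.
Proof. by rewrite /cexp/= cos0 sin0 mulr1 mulr0. Qed.

Lemma eta_integral_real a b (h : R -> R) :
  eta_integral a b (fun t => (h t)%:C) =
  (\int[mu]_(t in `[a, b]) (h t * eta_density a b t))%R%:C.
Proof.
rewrite /eta_integral; congr (_ +i* _).
by under eq_Rintegral do rewrite mul0r; rewrite Rintegral_cst// mul0r.
Qed.

Lemma szego_realE a b v x : a < b -> x \notin `[a, b] ->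
    mu.-integrable `[a, b] (EFin \o (fun t => ln (v t) * eta_density a b t)) ->
  szego a b v x%:C = (expR (log_szego a b v x))%:C.
Proof.
move=> ab xab iv; rewrite /szego sqrt_branch_real//.
rewrite (_ : (fun t : R => _) = fun t => (ln (v t) / (t - x))%:C); last first.
  by apply/funext => t; rewrite -rmorphB/= -fmorph_div.
rewrite eta_integral_real -fmorph_div -rmorphM/= cexp_real /log_szego.
congr ((expR _)%:C).
(* [t - x] keeps one sign on [a, b], positive exactly when [x < a]; multiplied by the sign of the
   root it always leaves -1. *)
have -> : \int[mu]_(t in `[a, b]) (ln (v t) / (t - x) * eta_density a b t) =
    - (-1) ^+ (x < a)%R *
    \int[mu]_(t in `[a, b]) (ln (v t) * eta_density a b t * `|t - x|^-1).
  rewrite -RintegralZl//; last first.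
    apply: integrable_mul_continuous => //.
    apply: within_continuous_inv.
      by move=> t /= tab; rewrite normr_eq0 (dist_neq0 xab).
    by apply: within_continuous_norm; exact: within_continuous_subr.
  apply: eq_Rintegral => t; rewrite inE/= => tab; have := tab.
  rewrite in_itv/= => /andP[at_ tb].
  case: (notin_itvcc ab xab) => x_lt.
    rewrite x_lt expr1 opprK mul1r gtr0_norm; last by lra.
    by rewrite mulrAC.
  rewrite ltNge (ltW (lt_trans ab x_lt)) expr0 ltr0_norm; last by lra.
  by rewrite invrN mulrAC; ring.
move: (Num.sqrt _) (Rintegral _ _ _) => s I.
have := pi_gt0 R; move: (pi : R) => p p0.
by case: (x < a); rewrite ?expr0 ?expr1; field; rewrite gt_eqF.
Qed.

Lemma log_szego_continuous a b v x : a < b -> x \notin `[a, b] ->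
    mu.-integrable `[a, b] (EFin \o (fun t => ln (v t) * eta_density a b t)) ->
  {for x, continuous (log_szego a b v)}.
Proof.
move=> ab xab iv.
(* [r] is half the distance from [x] to [a, b]: points within [r] of [x] stay at distance at least
   [r] from [a, b], which gives an integrable majorant with factor [r^-1]. *)
have [r r0 xr] : exists2 r, 0 < r &
    forall t, t \in `[a, b] -> r *+ 2 <= `|t - x|.
  case: (notin_itvcc ab xab) => x_lt.
    exists ((a - x) / 2); first by lra.
    move=> t; rewrite in_itv/= => /andP[? ?].
    by rewrite mulr2n gtr0_norm; lra.
  exists ((x - b) / 2); first by lra.
  move=> t; rewrite in_itv/= => /andP[? ?].
  by rewrite mulr2n ltr0_norm; lra.
have dist_r y t : y \in `]x - r, x + r[ -> t \in `[a, b] -> r <= `|t - y|.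
  rewrite in_itv/= => /andP[xy yx] /xr; rewrite mulr2n.
  have : `|y - x| < r by rewrite ltr_norml; lra.
  have := ler_normD (t - y) (y - x); rewrite addrA subrK; lra.
have cF : {in `]x - r, x + r[%classic, continuous (fun y =>
    \int[mu]_(t in `[a, b]) (ln (v t) * eta_density a b t * `|t - y|^-1))}.
  apply: (@continuity_under_integral _ _ _ mu
    (fun y t => ln (v t) * eta_density a b t * `|t - y|^-1) _ _ _ _ _ _
    (fun t => `|ln (v t) * eta_density a b t| * r^-1)) => //.
  - move=> y /= yr; apply: integrable_mul_continuous => //.
    apply: within_continuous_inv.
      by move=> t /= tab; rewrite gt_eqF// (lt_le_trans r0)// dist_r.
    by apply: within_continuous_norm; exact: within_continuous_subr.
  - apply: nearW => t /= tab y; rewrite inE/= => yr.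
    apply: (@continuousM _ _ (fun=> ln (v t) * eta_density a b t)
      (fun y => `|t - y|^-1)); first exact: cvg_cst.
    apply: continuousV; first by rewrite gt_eqF// (lt_le_trans r0)// dist_r.
    apply: (@continuous_comp _ _ _ (fun y => t - y) (fun z : R => `|z|));
      last exact: norm_continuous.
    by apply: continuousB => //; exact: cvg_cst.
  - apply: integrable_mul_continuous; first exact: integrable_norm.
    exact: continuous_subspaceT (fun => cvg_cst _).
  - move=> y /= yr; apply: nearW => t /= tab.
    rewrite normrM ler_wpM2l// normrV ?normr_id.
      by rewrite lef_pV2 ?posrE// ?dist_r// (lt_le_trans r0)// dist_r.
    by rewrite unitfE normr_eq0 -normr_gt0 (lt_le_trans r0)// dist_r.
apply: continuousN; apply: continuousM; first exact: cvg_cst.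
apply: continuousM; last by apply: cF; rewrite inE/= in_itv/=; lra.
apply: continuousM; last exact: cvg_cst.
apply: (@continuous_comp _ _ _ (fun y => (y - a) * (y - b)) Num.sqrt);
  last exact: sqrt_continuous.
by apply: continuousM; apply: continuousB => //; exact: cvg_cst.
Qed.

End SzegoReal.

(** * Continuity and logarithms of finite products *)

Section Products.
Context {R : realType} (I : Type) (r : seq I) (p : pred I).

Lemma within_continuous_prod (F : I -> R -> R) (A : set R) :
    (forall i, p i -> {within A, continuous (F i)}) ->
  {within A, continuous (fun t => \prod_(i <- r | p i) F i t)}.
Proof.
move=> cF; apply/subspace_continuousP => t At.
elim: r => [|i s IH].
  by under eq_fun do rewrite big_nil; exact: cvg_cst.
under eq_fun do rewrite big_cons.
case: (boolP (p i)) => // pi; apply: cvgM => //.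
by have /subspace_continuousP := cF i pi; exact.
Qed.

Lemma ln_prod_gt0 (F : I -> R) : (forall i, 0 < F i) ->
  ln (\prod_(i <- r | p i) F i) = \sum_(i <- r | p i) ln (F i).
Proof.
move=> F0; elim: r => [|i s IH]; first by rewrite !big_nil ln1.
by rewrite !big_cons; case: ifP => // _; rewrite lnM ?posrE ?prodr_gt0// IH.
Qed.

End Products.

(** * The Szegő map and the contraction estimate for its iterates *)

Section SzegoMap.
Context {R : realType} {m : nat}.
Context (a b : 'I_m -> R) (w : 'I_m -> R -> R).
Context (ab : forall j, a j < b j).
Context (disj : forall i j : 'I_m, i.+1 = j :> nat ->
  `[a i, b i]%classic `&` `[a j, b j]%classic = set0).
Context (w_L1 : forall j,
  eta_integrable (a j) (b j) (fun x => lne (w j x)%:E)).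

(** Disjointness of consecutive intervals enters here and places every evaluation point where the
    real formulas hold. *)
Lemma nbr_dom_notin (j : 'I_m) (x : nbr_dom a b j) : \val x \notin `[a j, b j].
Proof.
apply/negP => xj.
have [i /= /orP[/eqP ij|/eqP ji] xi] := set_valP x.
  have : (`[a i, b i]%classic `&` `[a j, b j]%classic) (\val x) by split.
  by rewrite disj.
have : (`[a j, b j]%classic `&` `[a i, b i]%classic) (\val x) by split.
by rewrite disj.
Qed.

Lemma itv_sub_nbr_dom (i j : 'I_m) : neighbours i j ->
  `[a j, b j]%classic `<=` nbr_dom a b i.
Proof. by move=> ij t tj; exists j => //=; rewrite /neighbours orbC. Qed.

Definition nbr_prod (f : Cplus a b) (j : 'I_m) (t : R) : R :=
  \prod_(i < m | neighbours i j) 'valL_1 (f i) t.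

(** The default value 1 keeps the extension positive off the domain, as the estimates for
    [log_szego] ask for positivity on the whole line. *)
Lemma valL_gt0 (f : Cplus a b) (i : 'I_m) (t : R) : 0 < 'valL_1 (f i) t.
Proof.
by rewrite /=; case: ('oinv_ _ t) => [x|] //=; exact: cplus_gt0.
Qed.

Lemma nbr_prod_gt0 (f : Cplus a b) (j : 'I_m) (t : R) : 0 < nbr_prod f j t.
Proof. by apply: prodr_gt0 => i _; exact: valL_gt0. Qed.

Lemma nbr_prod_continuous (f : Cplus a b) (j : 'I_m) :
  {within `[a j, b j], continuous (nbr_prod f j)}.
Proof.
apply: within_continuous_prod => i ij.
apply: continuous_subspaceW (itv_sub_nbr_dom ij) _.
apply/subspace_valL_continuousP'; exact: cplus_continuous.
Qed.

Lemma integrable_szego_weight (f : Cplus a b) (j : 'I_m) :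
  lebesgue_measure.-integrable `[a j, b j] (EFin \o (fun t =>
    ln (w j t / nbr_prod f j t) * eta_density (a j) (b j) t)).
Proof.
apply: integrable_ln_div_eta => //; first exact: nbr_prod_gt0.
exact: nbr_prod_continuous.
Qed.

(** The map is defined by its real formula; continuity of [log_szego] off the interval makes the
    image an element of [Cplus]. *)
Lemma szego_map_exists : exists T : Cplus a b -> Cplus a b,
  forall f j x, T f j x =
    expR (log_szego (a j) (b j) (fun t => w j t / nbr_prod f j t) (\val x)).
Proof.
suff /choice[T TE] : forall f : Cplus a b, exists g : Cplus a b, forall j x,
    g j x =
    expR (log_szego (a j) (b j) (fun t => w j t / nbr_prod f j t) (\val x)).
  by exists T.
move=> f; apply: (cplus_exp (L := fun j x =>
  log_szego (a j) (b j) (fun t => w j t / nbr_prod f j t) (\val x))) => j x.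
apply: (@continuous_comp _ _ _ set_val); first exact: initial_continuous.
apply: log_szego_continuous => //; first exact: nbr_dom_notin.
exact: integrable_szego_weight.
Qed.

Lemma ln_nbr_prod_le (f g : Cplus a b) (c : 'I_m -> R) (j : 'I_m) (t : R) :
    (forall i (x : nbr_dom a b i), `|ln (f i x / g i x)| <= c i) ->
    t \in `[a j, b j] ->
  `|ln (nbr_prod f j t / nbr_prod g j t)| <= \sum_(i < m | neighbours i j) c i.
Proof.
move=> fgc tj; rewrite /nbr_prod -prodf_div ln_prod_gt0; last first.
  by move=> i; rewrite divr_gt0// valL_gt0.
apply: le_trans (ler_norm_sum _ _ _) _; apply: ler_sum => i ij.
have ti : t \in nbr_dom a b i by rewrite inE; exact: itv_sub_nbr_dom tj.
pose x : nbr_dom a b i := exist _ t ti.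
have valLE (h : Cplus a b) : 'valL_1 (h i) t = h i x.
  by rewrite -{2}(valLK 1 (h i)).
by rewrite !valLE.
Qed.

Context (T : Cplus a b -> Cplus a b).
Context (TE : forall f j x, T f j x =
  expR (log_szego (a j) (b j) (fun t => w j t / nbr_prod f j t) (\val x))).

(** Bounds are kept componentwise because the gain comes only from the missing neighbours of the
    first and last components; a single maximum would lose it. *)
Lemma szego_map_step (f g : Cplus a b) (c : 'I_m -> R) :
    (forall i (x : nbr_dom a b i), `|ln (f i x / g i x)| <= c i) ->
  forall j (x : nbr_dom a b j),
    `|ln (T f j x / T g j x)| <= 2^-1 * \sum_(i < m | neighbours i j) c i.
Proof.
move=> fgc j x; rewrite !TE ln_div ?posrE ?expR_gt0// !expRK.
apply: log_szego_le => //; [exact: nbr_dom_notin|exact: nbr_prod_gt0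
  |exact: nbr_prod_continuous|exact: nbr_prod_gt0|exact: nbr_prod_continuous|].
by move=> t tj; exact: ln_nbr_prod_le.
Qed.

Lemma szego_map_iter_dist (f g : Cplus a b) : (2 <= m)%N ->
  cplus_dist (iter (uphalf m) T f) (iter (uphalf m) T g)
    <= contraction_rate R m * cplus_dist f g.
Proof.
(* [c k j] is the probability that the walk from site [j.+1] survives [k] steps. *)
move=> m_ge2; pose c := fix c k j : R := if k is k'.+1
  then 2^-1 * \sum_(i < m | neighbours i j) c k' i else 1.
have step k : forall j (x : nbr_dom a b j),
    `|ln (iter k T f j x / iter k T g j x)| <= c k j * cplus_dist f g.
  elim: k => [|k IH] j x; first by rewrite mul1r; exact: le_cplus_dist.
  rewrite [c _ _]/= -mulrA mulr_suml.
  exact: (szego_map_step (c := fun i => c k i * cplus_dist f g)).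
apply: cplus_dist_le => [|j x].
  apply: mulr_ge0; last exact: cplus_dist_ge0.
  by have /andP[] := contraction_rate_itv (R := R) m_ge2.
apply: le_trans (step _ j x) _; apply: ler_wpM2r; first exact: cplus_dist_ge0.
apply: le_trans (walk_bound_rate (ltn_ord j)).
by apply: walk_bound_iter => //; lia.
Qed.

End SzegoMap.

Theorem theorem1p6 (R : realType) (m : nat) (a b : 'I_m -> R)
  (w : 'I_m -> R -> R)
  (m_ge2 : (2 <= m)%N)
  (ab : forall j : 'I_m, a j < b j)
  (disj : forall i j : 'I_m, i.+1 = j :> nat ->
    `[a i, b i]%classic `&` `[a j, b j]%classic = set0)
  (w_ge0 : forall (j : 'I_m) (x : R), x \in `[a j, b j] -> 0 <= w j x)
  (w_L1 : forall j : 'I_m,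
    eta_integrable (a j) (b j) (fun x => lne (w j x)%:E)) :
  exists T : Cplus a b -> Cplus a b,
    [/\ is_szego_map w T,
        (forall F : set_system (Cplus a b),
          ProperFilter F -> cauchy F -> exists f : Cplus a b, F --> f),
        0 <= contraction_rate R m < 1,
        (forall f g : Cplus a b,
          cplus_dist (iter (uphalf m) T f) (iter (uphalf m) T g)
          <= contraction_rate R m * cplus_dist f g) &
        exists! f : Cplus a b, T f = f].
Proof.
have [T TE] := szego_map_exists ab disj w_L1.
have rate := @contraction_rate_itv R _ m_ge2.
exists T; split=> //.
- move=> f j x; rewrite TE; apply/esym/szego_realE => //.
    exact: nbr_dom_notin.
  exact: integrable_szego_weight.
- exact: cplus_complete.
- by move=> f g; exact: szego_map_iter_dist.
pose S := iter (uphalf m) T.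
have S_lip (f g : Cplus a b) : cplus_dist (S f) (S g) <=
    contraction_rate R m * cplus_dist f g by exact: szego_map_iter_dist.
have S_inj (f g : Cplus a b) : S f = f -> S g = g -> f = g.
  move=> fS gS; apply: cplus_dist_positivity; apply/eqP.
  rewrite eq_le cplus_dist_ge0 andbT leNgt; apply/negP => fg.
  have := S_lip f g; rewrite fS gS leNgt gtr_pMl//.
  by case/andP: rate => _ ->.
(* The constant vector 1 starts the iteration. *)
have [f0 _] := @cplus_exp R m a b (fun _ _ => 0) (fun _ _ => cvg_cst (0 : R)).
have [f Sf] := @contraction_fixpoint R (Cplus a b) S _ f0
  (@cplus_complete R m a b) rate S_lip.
exists f; split.
  (* [S] commutes with [T], so [T f] is also fixed by [S] and equals [f] by uniqueness. *)
  by apply: S_inj => //; rewrite /S -iterSr iterS -/(S f) Sf.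
by move=> g Tg; apply: S_inj => //; rewrite /S; elim: uphalf => //= k ->.
Qed.
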